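(* Let $d_1,d_2$ be positive integers and let $\rho=\sum_{\alpha=0}^{d_1^2-1}\sum_{\beta=0}^{d_2^2-1}C_{\beta\alpha}\,\Gamma_\alpha^T\otimes\Omega_\beta$ be a density operator on $H_{d_1}\otimes H_{d_2}$, with $C=(C_{\beta\alpha})$ its real $d_2^2\times d_1^2$ coefficient matrix. The criterion $$\|D_2(0)\,C\,D_1(0)\|_1\le \mathcal{N}_1(0)\,\mathcal{N}_2(0)=\sqrt{\frac{(d_1-1)(d_2-1)}{d_1d_2}}$$ is equivalent to the entire class $\mathcal{W}$ of entanglement witnesses; that is, $\rho$ satisfies this inequality if and only if $\operatorname{Tr}(W\rho)\ge 0$ for every $W\in\mathcal{W}$. Here $\mathcal{W}$ is the set of all entanglement witnesses $W=\sum_{\alpha,\beta}R_{\beta\alpha}\,\Gamma_\alpha^T\otimes\Omega_\beta$ whose real $d_2^2\times d_1^2$ coefficient matrix $R=\begin{pmatrix}R_{00}&\mathbf{s}\\ \mathbf{t}&\Lambda\end{pmatrix}$ satisfies $$\sqrt{d_2-1}\,\|\mathbf{t}\|+\sqrt{d_1-1}\,\|\mathbf{s}\|+\sqrt{(d_1-1)(d_2-1)}\,\|\Lambda\|_\infty\le R_{00}.$$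
   Context: $H_d$ is the complex Hilbert space of dimension $d$ and $L(H_d)$ is the space of linear operators on it, with Hilbert–Schmidt inner product $\langle A,B\rangle=\operatorname{Tr}(AB^\dagger)$. $\{\Gamma_0=I_{d_1}/\sqrt{d_1},\Gamma_1,\dots,\Gamma_{d_1^2-1}\}$ is a fixed orthonormal basis of $L(H_{d_1})$ consisting of Hermitian operators, with $\Gamma_i$ traceless for $i\ge1$; $\{\Omega_0=I_{d_2}/\sqrt{d_2},\Omega_1,\dots,\Omega_{d_2^2-1}\}$ is a fixed orthonormal basis of $L(H_{d_2})$ consisting of Hermitian operators, with $\Omega_k$ traceless for $k\ge1$. $T$ denotes the transpose in a fixed orthonormal basis of $H_{d_1}$. In the block form of $R$, $R_{00}\in\mathbb{R}$, $\mathbf{s}\in\mathbb{R}^{d_1^2-1}$ is a row, $\mathbf{t}\in\mathbb{R}^{d_2^2-1}$ is a column and $\Lambda$ is a $(d_2^2-1)\times(d_1^2-1)$ matrix. $\|\mathbf{s}\|,\|\mathbf{t}\|$ are Euclidean norms, $\|\cdot\|_\infty$ is the operator norm (largest singular value) and $\|\cdot\|_1$ is the trace norm (sum of singular values). For $x\ge0$, $D_i(x)=\operatorname{diag}\{x,1,\dots,1\}$ is the $d_i^2\times d_i^2$ diagonal matrix and $\mathcal{N}_i(x)=\sqrt{(d_i-1+x^2)/d_i}$, $i=1,2$. An entanglement witness is a Hermitian operator $W$ on $H_{d_1}\otimes H_{d_2}$ that has a negative eigenvalue and satisfies $\operatorname{Tr}(W\sigma)\ge0$ for every separable state $\sigma$,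 i.e. every finite convex combination $\sigma=\sum_i p_i\,\rho_i^{(1)}\otimes\rho_i^{(2)}$ of product density operators. *)

(* Defs.v *)
From HB Require Import structures.
From mathcomp Require Import all_boot all_order all_algebra.
From mathcomp Require Import spectral sesquilinear.
From mathcomp Require Export complex mxtens reals.

Set Implicit Arguments.
Unset Strict Implicit.
Unset Printing Implicit Defensive.
Import Order.TTheory GRing.Theory Num.Theory.
Local Open Scope ring_scope.
Local Open Scope sesquilinear_scope.
Local Open Scope complex_scope.

(* For d > 0 this is d ^ 2, split so that index 0 stands alone and the block
   operations ulsubmx, ursubmx, dlsubmx, drsubmx apply. *)
Notation dimL d := (1 + (d ^ 2 - 1))%N.

Section Operators.
Variable R : realType.
Local Notation C := R[i].

(* H_d is identified with C^d through its fixed orthonormal basis, so operators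
   are matrices, the transpose T is trmx, the adjoint is
   ^t*, and H_m (x) H_n is C^(m * n) with the Kronecker product tensmx. *)

Definition psd n (A : 'M[C]_n) : Prop :=
  A \is hermsymmx /\ forall v : 'cV[C]_n, 0 <= (v^t* *m A *m v) 0 0.

Definition density n (A : 'M[C]_n) : Prop := psd A /\ \tr A = 1.

Definition separable m n (S : 'M[C]_(m * n)) : Prop :=
  exists (k : nat) (p : 'I_k -> R) (A : 'I_k -> 'M[C]_m) (B : 'I_k -> 'M[C]_n),
    [/\ forall i, 0 <= p i, \sum_i p i = 1,
        forall i, density (A i), forall i, density (B i)
      & S = \sum_i (p i)%:C *: tensmx (A i) (B i)].

(* For Hermitian W and S the trace of W *m S is real; 0 <= z in R[i] means that
   z is real and nonnegative. *)
Definition entanglement_witness m n (W : 'M[C]_(m * n)) : Prop :=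
  [/\ W \is hermsymmx,
      exists2 a : R, a < 0 & eigenvalue W a%:C
    & forall S : 'M[C]_(m * n), separable S -> 0 <= \tr (W *m S)].

Definition hermitian_op_basis d (G : 'I_(dimL d) -> 'M[C]_d) : Prop :=
  [/\ basis_of {: 'M[C]_d}%VS (codom G),
      forall i j, \tr (G i *m (G j)^t*) = (i == j)%:R,
      forall i, G i \is hermsymmx,
      G ord0 = ((Num.sqrt d%:R)^-1)%:C *: 1%:M
    & forall i, i != ord0 -> \tr (G i) = 0].

Definition op_of_coef d1 d2 (G : 'I_(dimL d1) -> 'M[C]_d1)
    (O : 'I_(dimL d2) -> 'M[C]_d2) (A : 'M[R]_(dimL d2, dimL d1)) :
    'M[C]_(d1 * d2) :=
  \sum_a \sum_b (A b a)%:C *: tensmx (G a)^T (O b).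

(* The entries of spectral_diag H are the eigenvalues, with multiplicity, of the
   Hermitian matrix H (here nonnegative reals).  When n > m this lists n values,
   at least n - m of which are 0. *)
Definition singular_values m n (A : 'M[R]_(m, n)) : 'rV[R]_n :=
  let Ac := map_mx (real_complex R) A in
  \row_j Num.sqrt (complex.Re (spectral_diag (Ac^t* *m Ac) 0 j)).

Definition trace_norm m n (A : 'M[R]_(m, n)) : R :=
  \sum_j singular_values A 0 j.

Definition operator_norm m n (A : 'M[R]_(m, n)) : R :=
  \big[Num.max/0]_j singular_values A 0 j.

Definition euclid_norm n (v : 'rV[R]_n) : R :=
  Num.sqrt (\sum_j v 0 j ^+ 2).

Definition Dmx d (x : R) : 'M[R]_(dimL d) :=
  diag_mx (row_mx (const_mx x) (const_mx 1)).

Definition Nconst d (x : R) : R := Num.sqrt ((d%:R - 1 + x ^+ 2) / d%:R).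

Definition witness_class d1 d2 (G : 'I_(dimL d1) -> 'M[C]_d1)
    (O : 'I_(dimL d2) -> 'M[C]_d2) (W : 'M[C]_(d1 * d2)) : Prop :=
  entanglement_witness W /\
  exists2 A : 'M[R]_(dimL d2, dimL d1), W = op_of_coef G O A
    & Num.sqrt (d2%:R - 1) * euclid_norm (dlsubmx A)^T
      + Num.sqrt (d1%:R - 1) * euclid_norm (ursubmx A)
      + Num.sqrt ((d1%:R - 1) * (d2%:R - 1)) * operator_norm (drsubmx A)
      <= ulsubmx A 0 0.

End Operators.

(* Main.v *)
(* In the two bases Tr (W rho) is the pairing of the coefficient matrices, which
   splits into the corner, the row s, the column t and the block Lambda.
   A state evaluated on a traceless Hermitian orthonormal family in dimension d
   has a coordinate vector of norm at most N_d(0), because a traceless Hermitian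
   B has eigenvalues at most N_d(0) |B|; this controls the row and column of the
   coefficient matrix of rho through its marginals, and both Bloch vectors of a
   product state.  The duality of trace norm and operator norm controls the
   block: it yields Tr (W rho) >= 0 on the whole class, and, when the criterion
   fails, the polar factor of the lower block of C gives Lambda for a witness
   with s = t = 0 that detects rho. *)
Require Import Defs.
From HB Require Import structures.
From mathcomp Require Import all_boot all_order all_algebra.
From mathcomp Require Import spectral sesquilinear.
From mathcomp Require Import ring.
Import Order.TTheory GRing.Theory Num.Theory.
Local Open Scope ring_scope.
Local Open Scope complex_scope.
Local Open Scope sesquilinear_scope.
Set Implicit Arguments.
Unset Strict Implicit.
Unset Printing Implicit Defensive.

Local Notation "''[' u ]" := (dotmx u u) : ring_scope.

(** * Spectral decomposition of Hermitian and Gram matrices *)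

Section Spectral.
Variable C : numClosedFieldType.

Lemma adjmx_mul m n p (A : 'M[C]_(m, n)) (B : 'M[C]_(n, p)) :
  (A *m B)^t* = B^t* *m A^t*.
Proof. by rewrite trmx_mul map_mxM. Qed.

Lemma hermsymmxP n (A : 'M[C]_n) : reflect (A^t* = A) (A \is hermsymmx).
Proof.
apply: (iffP (is_hermitianmxP _ _ _)); rewrite expr0 scale1r => AE; exact: esym.
Qed.

Lemma hermitian_spectral n (A : 'M[C]_n) : A \is hermsymmx ->
  A = (spectralmx A)^t* *m diag_mx (spectral_diag A) *m spectralmx A.
Proof.
move=> /hermitian_normalmx /orthomx_spectralP {1}->.
by rewrite invmx_unitary ?spectral_unitarymx.
Qed.

Lemma gram_hermsymmx m n (B : 'M[C]_(m, n)) : B^t* *m B \is hermsymmx.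
Proof. by apply/hermsymmxP; rewrite adjmx_mul trmxCK. Qed.

Lemma dotmx_sum n (u : 'rV[C]_n) : '[u] = \sum_j `|u 0 j| ^+ 2.
Proof.
by rewrite dotmxE mxE; apply: eq_bigr => j _; rewrite !mxE -normCK.
Qed.

Lemma dotmx_row m n (A B : 'M[C]_(m, n)) i :
  dotmx (row i A) (row i B) = (A *m B^t*) i i.
Proof. by rewrite dotmxE !mxE; apply: eq_bigr => j _; rewrite !mxE. Qed.

Lemma dotmx_mulr m n (u : 'rV[C]_m) (B : 'M[C]_(m, n)) :
  '[u *m B] = (u *m (B *m B^t*) *m u^t*) 0 0.
Proof. by rewrite dotmxE adjmx_mul !mulmxA. Qed.

Lemma dotmx_unitary n (u : 'rV[C]_n) (Q : 'M[C]_n) :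
  Q \is unitarymx -> '[u *m Q] = '[u].
Proof. by move=> /unitarymxP QQ; rewrite dotmx_mulr QQ mulmx1 dotmxE. Qed.

(** The left side is the quadratic form of [H] at [u], which is diagonal in the eigenbasis of
    [H]. *)
Lemma dotmx_gram m n (B : 'M[C]_(m, n)) (u : 'rV[C]_n) :
  let H := B^t* *m B in
  '[u *m B^t*] = \sum_j spectral_diag H 0 j
                          * `|(u *m (spectralmx H)^t*) 0 j| ^+ 2.
Proof.
move=> H; rewrite dotmx_mulr trmxCK -/H.
set P := spectralmx H; set D := spectral_diag H.
have HE : H = P^t* *m diag_mx D *m P := hermitian_spectral (gram_hermsymmx B).
have PuE : P *m u^t* = (u *m P^t*)^t* by rewrite adjmx_mul trmxCK.
rewrite HE !mulmxA -(mulmxA _ P) PuE.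
rewrite mul_mx_diag mxE; apply: eq_bigr => j _.
by rewrite !mxE normCK mulrAC mulrA mulrC mulrA.
Qed.

(** An eigenvector row has a unit coordinate vector in the eigenbasis, so only one term of
    [dotmx_gram] survives. *)
Lemma row_spectral_gram m n (B : 'M[C]_(m, n)) j :
  let H := B^t* *m B in
  '[row j (spectralmx H) *m B^t*] = spectral_diag H 0 j.
Proof.
move=> H; rewrite dotmx_gram -/H.
have /unitarymxP PP := spectral_unitarymx H.
rewrite -row_mul PP (bigD1 j) //= big1 ?addr0 => [|i ij].
  by rewrite !mxE eqxx normr1 expr1n mulr1.
by rewrite !mxE eq_sym (negPf ij) normr0 expr0n mulr0.
Qed.

Lemma spectral_gram_ge0 m n (B : 'M[C]_(m, n)) j :
  0 <= spectral_diag (B^t* *m B) 0 j.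
Proof.
by rewrite -row_spectral_gram dotmx_sum sumr_ge0 // => i _; rewrite exprn_ge0.
Qed.

Lemma row_unitary_norm n (P : 'M[C]_n) j : P \is unitarymx -> '[row j P] = 1.
Proof. by move=> /row_unitarymxP/(_ j j); rewrite eqxx. Qed.

(** Parallelogram identity: entry by entry, the right side minus the left side is the squared
    modulus of half the difference. *)
Lemma dotmx_midpoint n (u v : 'rV[C]_n) :
  '[2^-1 *: (u + v)] <= 2^-1 * ('[u] + '[v]).
Proof.
rewrite !dotmx_sum -big_split /= mulr_sumr ler_sum // => j _.
rewrite !mxE -subr_ge0.
rewrite (_ : _ - _ = `|2^-1 * (u 0 j - v 0 j)| ^+ 2) ?exprn_ge0 //.
rewrite !normCK !rmorphM !rmorphD rmorphN fmorphV rmorph_nat.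
move: (u 0 j) (v 0 j) => x y; set x' := Num.conj x; set y' := Num.conj y.
by field.
Qed.

End Spectral.

(** * Duality of the trace norm and the operator norm *)

Section TraceDuality.
Variable R : realType.
Local Notation C := R[i].
Local Notation toC := (map_mx (real_complex R)).

(** A bound [L] on the operator norm. It is tested on complex rows because the eigenvectors supplied
    by [spectralmx] are complex rows. Only [L ^+ 2] occurs, so the sign of [L] is a separate
    hypothesis where it matters. *)
Definition norm_le (L : R) m n (M : 'M[R]_(m, n)) : Prop :=
  forall u : 'rV[C]_n, '[u *m (toC M)^t*] <= (L ^+ 2)%:C * '[u].

Lemma real_complex_Re (z : C) : 0 <= z -> z = (complex.Re z)%:C.
Proof. by move=> /ger0_real /RRe_real. Qed.

Lemma Re_sum I (r : seq I) (P : pred I) (F : I -> C) :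
  complex.Re (\sum_(i <- r | P i) F i) = \sum_(i <- r | P i) complex.Re (F i).
Proof. exact: (raddf_sum (@complex.Re R : {additive Rcomplex R -> R})). Qed.

Lemma Re_mulrC (a : R) (z : C) : complex.Re (a%:C * z) = a * complex.Re z.
Proof. by case: z => x y /=; rewrite mul0r subr0. Qed.

Lemma conjC_real_complex (x : R) : Num.conj x%:C = x%:C.
Proof. exact: conjc_real. Qed.

Lemma dotmx_ge0 n (u : 'rV[C]_n) : 0 <= '[u].
Proof. by rewrite dotmx_sum sumr_ge0 // => i _; rewrite exprn_ge0. Qed.

Lemma singular_value_sqr m n (M : 'M[R]_(m, n)) j :
  ((singular_values M 0 j) ^+ 2)%:C =
    spectral_diag ((toC M)^t* *m toC M) 0 j.
Proof.
have D_ge0 := spectral_gram_ge0 (toC M) j.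
rewrite mxE sqr_sqrtr; first by rewrite -real_complex_Re.
by rewrite -lecR -real_complex_Re.
Qed.

Lemma singular_value_ge0 m n (M : 'M[R]_(m, n)) j : 0 <= singular_values M 0 j.
Proof. by rewrite mxE sqrtr_ge0. Qed.

Lemma operator_norm_ge0 m n (M : 'M[R]_(m, n)) : 0 <= operator_norm M.
Proof. exact: bigmax_ge_id. Qed.

Lemma norm_le_operator_norm m n (M : 'M[R]_(m, n)) :
  norm_le (operator_norm M) M.
Proof.
move=> u; set H := (toC M)^t* *m toC M.
rewrite dotmx_gram -/H.
have PU : (spectralmx H)^t* \is unitarymx.
  by rewrite trmxC_unitary spectral_unitarymx.
rewrite -[in leRHS](dotmx_unitary u PU) dotmx_sum mulr_sumr ler_sum // => j _.
rewrite ler_wpM2r ?exprn_ge0 // -singular_value_sqr lecR.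
rewrite lerXn2r ?nnegrE ?singular_value_ge0 ?operator_norm_ge0 //.
exact: le_bigmax.
Qed.

(** Each singular value is the length of the image of a unit eigenvector of the Gram matrix, so
    testing on those rows suffices. *)
Lemma operator_norm_le m n (M : 'M[R]_(m, n)) L :
  0 <= L -> norm_le L M -> operator_norm M <= L.
Proof.
move=> L0 ML; apply: bigmax_le => // j _.
rewrite -(@ler_pXn2r _ 2) ?nnegrE ?singular_value_ge0 // -lecR.
rewrite singular_value_sqr -row_spectral_gram.
apply: le_trans (ML _) _.
by rewrite row_unitary_norm ?mulr1 ?spectral_unitarymx.
Qed.

Lemma cauchy_schwarz_Re n (u v : 'rV[C]_n) a b : 0 <= a -> 0 <= b ->
  '[u] <= (a ^+ 2)%:C -> '[v] <= (b ^+ 2)%:C -> complex.Re (dotmx u v) <= a * b.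
Proof.
move=> a0 b0 ua vb; apply: le_trans (ler_norm _) _.
rewrite -lecR; apply: le_trans (normc_ge_Re _) _.
rewrite -(@ler_pXn2r _ 2) ?nnegrE ?normr_ge0 //; last first.
  by rewrite ler0c mulr_ge0.
have [le_uv _] := CauchySchwarz (@dotmx C n) u v.
apply: le_trans le_uv _; rewrite -rmorphXn exprMn rmorphM.
exact: ler_pM (dotmx_ge0 _) (dotmx_ge0 _) ua vb.
Qed.

(** The trace is expanded in the eigenbasis of the Gram matrix of [M]. Term [j] pairs the images of
    a unit vector under [X] and [M], of lengths at most [L] and exactly the [j]-th singular value;
    Cauchy-Schwarz bounds it. *)
Lemma inner_le_trace_norm m n (X M : 'M[R]_(m, n)) L :
  0 <= L -> norm_le L X -> \tr (X^T *m M) <= L * trace_norm M.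
Proof.
move=> L0 XL; set H := (toC M)^t* *m toC M; set P := spectralmx H.
have PU : P \is unitarymx := spectral_unitarymx _.
have trE : (\tr (X^T *m M))%:C =
    \sum_j dotmx (row j P *m (toC X)^t*) (row j P *m (toC M)^t*).
  transitivity (\tr ((P *m (toC X)^t*) *m (P *m (toC M)^t*)^t*)).
    rewrite adjmx_mul trmxCK mulmxA [RHS]mxtrace_mulC !mulmxA.
    have /unitarymxP : P^t* \is unitarymx by rewrite trmxC_unitary.
    rewrite trmxCK => ->.
    rewrite mul1mx -trace_map_mx map_mxM; congr (\tr (_ *m _)).
    by apply/matrixP=> i j; rewrite !mxE conjC_real_complex.
  by apply: eq_bigr => j _; rewrite -!row_mul dotmx_row.
rewrite (_ : \tr _ = complex.Re (\tr (X^T *m M))%:C) // trE Re_sum.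
rewrite mulr_sumr ler_sum // => j _; apply: cauchy_schwarz_Re => //.
- exact: singular_value_ge0.
- by apply: le_trans (XL _) _; rewrite row_unitary_norm ?mulr1.
- by rewrite row_spectral_gram singular_value_sqr.
Qed.

(* Re X is the midpoint of X and its entrywise conjugate. *)
Lemma norm_le_Re m n (X : 'M[C]_(m, n)) :
  (forall u : 'rV[C]_n, '[u *m X^t*] <= '[u]) ->
  norm_le 1 (map_mx (@complex.Re R) X).
Proof.
move=> X_le u; rewrite expr1n mul1r.
pose a := u *m X^t*; pose b := u *m X^T.
(* Conjugating [u *m X^T] entrywise gives the conjugate of [u] times [X^t*], and conjugation
   preserves norms. *)
have b_le : '[b] <= '[u].
  have -> : '[b] = '[map_mx Num.conj u *m X^t*].
    rewrite -map_mxM !dotmx_sum; apply: eq_bigr => j _.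
    by rewrite [in RHS]mxE norm_conjC.
  apply: le_trans (X_le _) _; rewrite !dotmx_sum ler_sum // => j _.
  by rewrite mxE norm_conjC.
have -> : u *m (toC (map_mx (@complex.Re R) X))^t* = 2^-1 *: (a + b).
  rewrite /a /b -mulmxDr scalemxAr; congr (_ *m _).
  apply/matrixP => i j; rewrite !mxE conjC_real_complex ReJ_add addrC.
  by rewrite mulrC.
apply: le_trans (dotmx_midpoint _ _) _.
rewrite ler_pdivrMl ?ltr0n // mulr_natl mulr2n.
by apply: lerD; [apply: X_le|apply: b_le].
Qed.

(** The extremal [X] is the real part of the polar factor of [M]. Passing to the real part keeps a
    contraction and, as [M] is real, does not change the real part of the trace. *)
Lemma trace_norm_attained m n (M : 'M[R]_(m, n)) :
  exists2 X : 'M[R]_(m, n), norm_le 1 X & \tr (X^T *m M) = trace_norm M.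
Proof.
set H := (toC M)^t* *m toC M; set P := spectralmx H.
have PU : P \is unitarymx := spectral_unitarymx _.
have PP : P *m P^t* = 1%:M by apply/unitarymxP.
have PP' : P^t* *m P = 1%:M.
  by have /unitarymxP : P^t* \is unitarymx; rewrite ?trmxC_unitary // trmxCK.
pose s := toC (singular_values M).
(* Since the inverse of 0 is 0, [S] is a pseudo-inverse of the diagonal of singular values, and [X]
   below is a partial isometry even when [M] is singular. *)
pose S : 'M[C]_n := diag_mx (\row_j (s 0 j)^-1).
have s_ge0 j : 0 <= s 0 j by rewrite mxE ler0c singular_value_ge0.
have SH : S^t* = S.
  rewrite tr_diag_mx map_diag_mx; congr diag_mx; apply/rowP => j.
  by rewrite !mxE fmorphV /= conjC_real_complex.
pose X := toC M *m P^t* *m S *m P.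
have XE : X^t* = P^t* *m S *m P *m (toC M)^t*.
  by rewrite !adjmx_mul SH trmxCK !mulmxA.
exists (map_mx (@complex.Re R) X).
  apply: norm_le_Re => u; rewrite XE mulmxA dotmx_gram -/H -/P.
  have PU' : P^t* \is unitarymx by rewrite trmxC_unitary.
  rewrite -(dotmx_unitary u PU') dotmx_sum ler_sum // => j _.
  rewrite -!mulmxA PP mulmx1 mulmxA mul_mx_diag.
  move: (u *m P^t*) => w; rewrite [X in `|X|]mxE -singular_value_sqr.
  have -> : (\row_j (s 0 j)^-1) 0 j = ((singular_values M 0 j)%:C)^-1.
    by rewrite !mxE.
  rewrite normrM normfV mulrC.
  rewrite [X in X^-1]ger0_norm ?ler0c ?singular_value_ge0 //.
  rewrite exprMn rmorphXn -mulrA.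
  have [->|s_neq0] := eqVneq (singular_values M 0 j) 0.
    rewrite rmorph0 [X in _ * (_ * X)]expr0n !mulr0.
    exact: exprn_ge0.
  by rewrite -exprMn mulVf ?expr1n ?mulr1 // fmorph_eq0.
rewrite (_ : \tr _ = complex.Re (\tr (X^t* *m toC M))); last first.
  rewrite /mxtrace Re_sum; apply: eq_bigr => j _; rewrite !mxE Re_sum.
  apply: eq_bigr => i _; rewrite !mxE mulrC -Re_mulrC mulrC.
  by case: (\sum_(_ < _) _) => x y /=; rewrite !mulr0 !subr0.
have HE : H = P^t* *m diag_mx (spectral_diag H) *m P :=
  hermitian_spectral (gram_hermsymmx (toC M)).
(* The eigenvalues of [H] are squared singular values, so one factor cancels; zero singular values
   give 0 on both sides. *)
have SD : S *m diag_mx (spectral_diag H) = diag_mx s.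
  rewrite mulmx_diag; congr diag_mx; apply/rowP => j.
  rewrite [LHS]mxE -singular_value_sqr [X in X * _]mxE rmorphXn !mxE.
  move: (Num.sqrt _) => t; have [->|t_neq0] := eqVneq t 0.
    by rewrite rmorph0 invr0 mul0r.
  by rewrite expr2 mulKf // fmorph_eq0.
rewrite XE -!mulmxA -/H mxtrace_mulC {1}HE -!mulmxA PP mulmx1 !mulmxA.
rewrite -(mulmxA S) PP mulmx1 SD mxtrace_diag Re_sum.
by apply: eq_bigr => j _; rewrite mxE.
Qed.

End TraceDuality.

(** * Block matrices, Euclidean norms and the pairing of coefficient matrices *)

Section Blocks.
Variable R : realType.
Local Notation C := R[i].
Local Notation toC := (map_mx (real_complex R)).

Lemma dotmx_row_mx n1 n2 (u : 'rV[C]_n1) (v : 'rV[C]_n2) :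
  '[row_mx u v] = '[u] + '[v].
Proof.
rewrite !dotmx_sum big_split_ord /=; congr (_ + _); apply: eq_bigr => j _.
  by rewrite row_mxEl.
by rewrite row_mxEr.
Qed.

Lemma norm_le_block_mx m1 m2 n1 n2 (M : 'M[R]_(m2, n2)) L :
  norm_le L M -> norm_le L (block_mx (0 : 'M_(m1, n1)) 0 0 M).
Proof.
move=> ML u; rewrite -[u]hsubmxK map_block_mx !map_mx0 tr_block_mx map_block_mx.
rewrite !trmx0 !map_mx0 mul_row_block !mulmx0 !add0r !dotmx_row_mx mulrDr.
rewrite lerD // [leLHS]dotmx_sum big1 => [|j _].
  by rewrite mulr_ge0 ?dotmx_ge0 // ler0c sqr_ge0.
by rewrite mxE normr0 expr0n.
Qed.

(** Padding [u] with zeros keeps its norm, and the image under the block is part of the image under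
    [M]. *)
Lemma norm_le_drsubmx m1 m2 n1 n2 (M : 'M[R]_(m1 + m2, n1 + n2)) L :
  norm_le L M -> norm_le L (drsubmx M).
Proof.
move=> ML u; have := ML (row_mx 0 u).
have -> : row_mx 0 u *m (toC M)^t* =
    row_mx (u *m (toC (ursubmx M))^t*) (u *m (toC (drsubmx M))^t*).
  rewrite -{1}[M]submxK map_block_mx tr_block_mx map_block_mx mul_row_block.
  by rewrite !mul0mx !add0r.
rewrite !dotmx_row_mx.
have -> : '[0 : 'rV[C]_n1] = 0.
  by rewrite dotmx_sum big1 // => j _; rewrite mxE normr0 expr0n.
by rewrite add0r => /(le_trans _); apply; rewrite lerDr dotmx_ge0.
Qed.

Lemma norm_leN m n (M : 'M[R]_(m, n)) L : norm_le L M -> norm_le L (- M).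
Proof.
by move=> ML u; rewrite map_mxN linearN map_mxN mulmxN hnormN; apply: ML.
Qed.

Lemma norm_leZ m n (M : 'M[R]_(m, n)) L a :
  norm_le L M -> norm_le (a * L) (a *: M).
Proof.
move=> ML u.
have -> : u *m (toC (a *: M))^t* = a%:C *: (u *m (toC M)^t*).
  rewrite scalemxAr; congr (_ *m _); apply/matrixP => i j.
  by rewrite !mxE !conjC_real_complex rmorphM.
rewrite dnormZ normCK conjC_real_complex -expr2 -rmorphXn.
rewrite [X in _ <= X%:C * _]exprMn [X in _ <= X * _]rmorphM -mulrA.
by rewrite ler_wpM2l ?ML // ler0c sqr_ge0.
Qed.

Lemma dotmx_real n (u v : 'rV[R]_n) :
  dotmx (toC u) (toC v) = (\sum_j u 0 j * v 0 j)%:C.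
Proof.
rewrite dotmxE mxE rmorph_sum; apply: eq_bigr => j _.
by rewrite !mxE conjC_real_complex rmorphM.
Qed.

Lemma euclid_norm_ge0 n (u : 'rV[R]_n) : 0 <= euclid_norm u.
Proof. exact: sqrtr_ge0. Qed.

Lemma sqr_euclid_norm n (u : 'rV[R]_n) : euclid_norm u ^+ 2 = \sum_j u 0 j ^+ 2.
Proof. by rewrite sqr_sqrtr // sumr_ge0 // => j _; rewrite sqr_ge0. Qed.

Lemma euclid_normN n (u : 'rV[R]_n) : euclid_norm (- u) = euclid_norm u.
Proof. by congr Num.sqrt; apply: eq_bigr => j _; rewrite mxE sqrrN. Qed.

Lemma euclid_normZ n a (u : 'rV[R]_n) : 0 <= a ->
  euclid_norm (a *: u) = a * euclid_norm u.
Proof.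
move=> a0; rewrite -[X in X * _](ger0_norm a0) -sqrtr_sqr -sqrtrM ?sqr_ge0 //.
by rewrite mulr_sumr; congr Num.sqrt; apply: eq_bigr => j _; rewrite mxE exprMn.
Qed.

Lemma dotmx_euclid_norm n (u : 'rV[R]_n) : '[toC u] = (euclid_norm u ^+ 2)%:C.
Proof.
by rewrite dotmx_real sqr_euclid_norm.
Qed.

(** Rank-one duality, for product states: by cyclicity the trace is the inner product of [x *m M^T]
    with [y]. *)
Lemma norm_le_pairing m n (M : 'M[R]_(m, n)) L (x : 'rV[R]_n) (y : 'rV[R]_m) :
  0 <= L -> norm_le L M ->
  \tr (M^T *m (y^T *m x)) <= L * (euclid_norm x * euclid_norm y).
Proof.
move=> L0 ML.
rewrite mulmxA mxtrace_mulC mulmxA trace_mx11.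
rewrite (_ : _ 0 0 = complex.Re (dotmx (toC x *m (toC M)^t*) (toC y))).
  rewrite mulrA; apply: cauchy_schwarz_Re.
  - by rewrite mulr_ge0 ?euclid_norm_ge0.
  - exact: euclid_norm_ge0.
  - by apply: le_trans (ML _) _; rewrite dotmx_euclid_norm -rmorphM -exprMn.
  - by rewrite dotmx_euclid_norm.
have -> : (toC M)^t* = toC M^T.
  by apply/matrixP => i j; rewrite !mxE conjC_real_complex.
rewrite -map_mxM dotmx_real /= mxE.
by apply: eq_bigr => j _; congr (_ * _); rewrite mxE.
Qed.

Lemma cauchy_schwarz n (u v : 'rV[R]_n) :
  \sum_j u 0 j * v 0 j <= euclid_norm u * euclid_norm v.
Proof.
rewrite (_ : \sum_j _ = complex.Re (dotmx (toC u) (toC v))) ?dotmx_real //.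
by rewrite -dotmx_real; apply: cauchy_schwarz_Re;
  rewrite ?euclid_norm_ge0 ?dotmx_euclid_norm.
Qed.

Lemma cauchy_schwarzN n (u v : 'rV[R]_n) :
  - (euclid_norm u * euclid_norm v) <= \sum_j u 0 j * v 0 j.
Proof.
rewrite lerNl -(euclid_normN u); apply: le_trans (cauchy_schwarz _ _).
by rewrite -sumrN ler_sum // => j _; rewrite mxE mulNr.
Qed.

Lemma pairing_block m n (A B : 'M[R]_(1 + m, 1 + n)) :
  \tr (A^T *m B) = ulsubmx A 0 0 * ulsubmx B 0 0
    + \sum_j ursubmx A 0 j * ursubmx B 0 j
    + \sum_j (dlsubmx A)^T 0 j * (dlsubmx B)^T 0 j
    + \tr ((drsubmx A)^T *m drsubmx B).
Proof.
rewrite -{1}[A]submxK -{1}[B]submxK tr_block_mx mulmx_block mxtrace_block.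
rewrite !mxtraceD addrA !trace_mx11.
congr (_ + _); rewrite addrAC; congr (_ + _ + _).
- by rewrite mxE big_ord1 [_^T _ _]mxE.
- apply: eq_bigr => j _; rewrite mxE big_ord1. by rewrite [_^T _ _]mxE.
- by rewrite [LHS]mxE; apply: eq_bigr => j _; congr (_ * _); rewrite [RHS]mxE.
Qed.

(** [Dmx d 0] is the projection that kills index 0, so the criterion sees only the correlation
    block. *)
Lemma Dmx0_mul d1 d2 (A : 'M[R]_(dimL d2, dimL d1)) :
  Dmx d2 0 *m A *m Dmx d1 0 = block_mx 0 0 0 (drsubmx A).
Proof.
have DE d : Dmx d 0 = block_mx 0 0 0 1%:M :> 'M[R]_(dimL d).
  by rewrite /Dmx diag_mx_row diag_const_mx diag_const_mx raddf0.
rewrite !DE -{1}[A]submxK !mulmx_block.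
by rewrite !(mul0mx, mulmx0, mulmx1, mul1mx, addr0, add0r).
Qed.

End Blocks.

(** * The bound on Bloch vectors *)

Section Bloch.
Variable R : realType.
Local Notation C := R[i].
Local Notation toC := (map_mx (real_complex R)).

Lemma Nconst_ge0 d (x : R) : 0 <= Nconst d x.
Proof. exact: sqrtr_ge0. Qed.

Lemma Nconst0E d : Nconst d (0 : R) = Num.sqrt (d%:R - 1) * (Num.sqrt d%:R)^-1.
Proof.
(* For [d = 0] both sides vanish, because the inverse of 0 is 0. *)
rewrite /Nconst expr0n addr0; have [->|d_gt0] := posnP d.
  by rewrite invr0 mulr0 sqrtr0 invr0 mulr0.
by rewrite sqrtrM ?subr_ge0 ?ler1n // sqrtrV ?ler0n.
Qed.

(** As [v] has sum 0, its entry [j] is also its inner product with the [j]-th unit vector minus its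
    mean. That centred vector has squared length [(d - 1) / d]. *)
Lemma le_norm_of_sum0 d (v : 'rV[R]_d) j : \sum_k v 0 k = 0 ->
  v 0 j <= euclid_norm v * Nconst d 0.
Proof.
move=> v0; have d0 : (0 < d)%N := leq_ltn_trans (leq0n j) (ltn_ord j).
pose e : 'rV[R]_d := \row_k ((k == j)%:R - d%:R^-1).
have -> : Nconst d 0 = euclid_norm e.
  congr Num.sqrt; rewrite expr0n addr0.
  under [RHS]eq_bigr do rewrite mxE sqrrB.
  have d_neq0 : d%:R != 0 :> R by rewrite pnatr_eq0 -lt0n.
  rewrite big_split /= sumr_const card_ord sumrB (bigD1 j) //= eqxx.
  rewrite big1 => [|k /negPf ->]; last by rewrite expr0n.
  rewrite (bigD1 j) //= eqxx big1 => [|k /negPf ->]; last first.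
    by rewrite mul0r mul0rn.
  by rewrite -[_ *+ d]mulr_natr -[true%:R]/(1 : R); field.
apply: le_trans (cauchy_schwarz _ _); rewrite le_eqVlt; apply/orP; left.
under eq_bigr do rewrite mxE mulrBr.
rewrite sumrB -mulr_suml v0 mul0r subr0 (bigD1 j) //= eqxx mulr1.
by rewrite big1 ?addr0 // => k /negPf ->; rewrite mulr0.
Qed.

Lemma spectral_sum d (B : 'M[C]_d) : B \is hermsymmx ->
  B = \sum_j spectral_diag B 0 j
        *: ((row j (spectralmx B))^t* *m row j (spectralmx B)).
Proof.
move=> Bh; rewrite {1}(hermitian_spectral Bh); apply/matrixP => i k.
rewrite summxE mul_mx_diag mxE; apply: eq_bigr => j _.
by rewrite !mxE big_ord1 !mxE mulrAC mulrC.
Qed.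

Lemma unitary_sum d (P : 'M[C]_d) : P \is unitarymx ->
  1%:M = \sum_j ((row j P)^t* *m row j P).
Proof.
rewrite -trmxC_unitary => /unitarymxP; rewrite trmxCK => <-.
apply/matrixP => i k; rewrite summxE mxE; apply: eq_bigr => j _.
by rewrite !mxE big_ord1 !mxE.
Qed.

(* The coordinates x of a state f make B = sum_i x_i g_i a traceless Hermitian
   matrix with f B = tr (B B) = |x|^2, while f B is at most the largest
   eigenvalue of B, which is at most N_d(0) times the Hilbert-Schmidt norm. *)
Lemma state_coord_bound d n (g : 'I_n -> 'M[C]_d) (f : 'M[C]_d -> C) :
  (forall i, g i \is hermsymmx) ->
  (forall i j, \tr (g i *m g j) = (i == j)%:R) ->
  (forall i, \tr (g i) = 0) ->
  scalar f -> f 1%:M = 1 -> (forall v : 'rV[C]_d, 0 <= f (v^t* *m v)) ->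
  euclid_norm (\row_i complex.Re (f (g i))) <= Nconst d 0.
Proof.
move=> g_herm g_orth g_tr f_lin f1 f_pos.
pose F := HB.pack f (GRing.isLinear.Build _ _ _ _ f f_lin) : {scalar 'M[C]_d}.
set x := \row_i _; pose B : 'M[C]_d := \sum_i (x 0 i)%:C *: g i.
set beta := euclid_norm x.
have Bh : B \is hermsymmx.
  apply/hermsymmxP; rewrite /B raddf_sum /= raddf_sum /=; apply: eq_bigr => i _.
  by rewrite linearZ map_mxZ /= conjC_real_complex (hermsymmxP _ (g_herm i)).
have fB : complex.Re (f B) = beta ^+ 2.
  rewrite sqr_euclid_norm -[f B]/(F B) linear_sum /= Re_sum.
  apply: eq_bigr => i _; rewrite -[f _]/(F _) linearZ /= Re_mulrC.
  by rewrite [in RHS]mxE expr2 mxE.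
have trB : \tr B = 0.
  by rewrite raddf_sum big1 //= => i _; rewrite mxtraceZ g_tr mulr0.
have trBB : \tr (B *m B) = (beta ^+ 2)%:C.
  rewrite mulmx_suml raddf_sum sqr_euclid_norm rmorph_sum.
  apply: eq_bigr => i _; rewrite mulmx_sumr raddf_sum (bigD1 i) //= big1 => [|j /negPf ij].
    by rewrite -scalemxAl -scalemxAr !mxtraceZ g_orth eqxx mulr1 addr0 rmorphXn.
  by rewrite -scalemxAl -scalemxAr !mxtraceZ g_orth eq_sym ij !mulr0.
set P := spectralmx B; have PU : P \is unitarymx := spectral_unitarymx B.
have PP : P *m P^t* = 1%:M by apply/unitarymxP.
pose D : 'rV[R]_d := map_mx (@complex.Re R) (spectral_diag B).
have DE : spectral_diag B = toC D.
  have /mxOverP Dreal := hermitian_spectral_diag_real Bh.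
  by apply/rowP => j; rewrite !mxE RRe_real.
have BE : B = P^t* *m diag_mx (toC D) *m P.
  by rewrite -DE; apply: hermitian_spectral.
(* The eigenvalue vector [D] has sum [\tr B] and squared length [\tr (B *m B)], so [le_norm_of_sum0]
   applies to it. *)
have D0 : \sum_j D 0 j = 0.
  apply: (@complexI R); rewrite rmorph0 -[RHS]trB BE -mulmxA mxtrace_mulC.
  rewrite -mulmxA PP mulmx1 mxtrace_diag rmorph_sum.
  by apply: eq_bigr => j _; rewrite [RHS]mxE.
have Dnorm : euclid_norm D = beta.
  apply/eqP; rewrite -(@eqrXn2 _ 2) ?euclid_norm_ge0 //; apply/eqP.
  apply: (@complexI R); rewrite -trBB sqr_euclid_norm BE.
  rewrite -!mulmxA (mulmxA P) PP mul1mx mxtrace_mulC -!mulmxA PP mulmx1.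
  rewrite mulmx_diag mxtrace_diag rmorph_sum.
  by apply: eq_bigr => j _; rewrite !mxE rmorphM.
(* The values of the state on the eigenprojections of [B] form a probability vector, which makes
   [f B] an average of eigenvalues. *)
pose p j := complex.Re (f ((row j P)^t* *m row j P)).
have p0 j : 0 <= p j by rewrite -ler0c -real_complex_Re ?f_pos.
have p1 : \sum_j p j = 1.
  rewrite -[RHS]/(complex.Re (1 : C)) -f1 (unitary_sum PU) -Re_sum.
  by congr complex.Re; rewrite -[RHS]/(F _) linear_sum.
have fBp : complex.Re (f B) = \sum_j D 0 j * p j.
  rewrite (spectral_sum Bh) -[f _]/(F _) linear_sum Re_sum.
  by apply: eq_bigr => j _; rewrite linearZ /= DE [toC D 0 j]mxE Re_mulrC.
have beta_le : beta ^+ 2 <= beta * Nconst d 0.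
  rewrite -fB fBp -[leRHS]mulr1 -p1 mulr_sumr ler_sum // => j _.
  by rewrite ler_wpM2r // -Dnorm le_norm_of_sum0.
(* One factor [beta] can be cancelled only when it is positive; at 0 the bound is trivial. *)
have := euclid_norm_ge0 x; rewrite -/beta le_eqVlt => /orP[/eqP <-|beta_gt0].
  exact: Nconst_ge0.
by rewrite -(ler_pM2l beta_gt0) -expr2.
Qed.

End Bloch.

(** * Operators on the tensor product and their coordinates *)

Section Operators.
Variable R : realType.
Local Notation C := R[i].

Lemma adjmx_tens m n p q (A : 'M[C]_(m, n)) (B : 'M[C]_(p, q)) :
  (tensmx A B)^t* = tensmx (A^t*) (B^t*).
Proof. by rewrite trmx_tens map_mxT. Qed.

Lemma tensmxPl m n p q (a : C) (A A' : 'M[C]_(m, n)) (B : 'M[C]_(p, q)) :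
  tensmx (a *: A + A') B = a *: tensmx A B + tensmx A' B.
Proof. by apply/matrixP => i j; rewrite !mxE mulrDl mulrA. Qed.

Lemma tensmxPr m n p q (a : C) (A : 'M[C]_(m, n)) (B B' : 'M[C]_(p, q)) :
  tensmx A (a *: B + B') = a *: tensmx A B + tensmx A B'.
Proof. by apply/matrixP => i j; rewrite !mxE mulrDr mulrCA. Qed.

Lemma tensmxZl m n p q (a : C) (A : 'M[C]_(m, n)) (B : 'M[C]_(p, q)) :
  tensmx (a *: A) B = a *: tensmx A B.
Proof. by apply/matrixP => i j; rewrite !mxE mulrA. Qed.

Lemma tensmxZr m n p q (a : C) (A : 'M[C]_(m, n)) (B : 'M[C]_(p, q)) :
  tensmx A (a *: B) = a *: tensmx A B.
Proof. by apply/matrixP => i j; rewrite !mxE mulrCA. Qed.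

Lemma tensmx11 m n : tensmx (1%:M : 'M[C]_m) (1%:M : 'M[C]_n) = 1%:M.
Proof.
apply/matrixP => i j.
case: (mxtens_indexP i) => i1 i2; case: (mxtens_indexP j) => j1 j2.
rewrite tensmxE !mxE (can_eq (@mxtens_indexK _ _)) xpair_eqE -natrM mulnb //.
Qed.

Lemma mxtrace_tens m n (A : 'M[C]_m) (B : 'M[C]_n) :
  \tr (tensmx A B) = \tr A * \tr B.
Proof. by rewrite /mxtrace mulr_sum; apply: eq_bigr => i _; rewrite mxE. Qed.

(** Keeps positivity when an operator on one factor is extended by the identity; hence the marginals
    of a state are positive functionals. *)
Lemma tens_gram1 m n p (A : 'M[C]_(m, n)) :
  tensmx (A^t* *m A) (1%:M : 'M_p) = (tensmx A 1%:M)^t* *m tensmx A 1%:M.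
Proof. by rewrite adjmx_tens tensmx_mul trmx1 map_mx1 mulmx1. Qed.

Lemma tens_1gram m n p (A : 'M[C]_(m, n)) :
  tensmx (1%:M : 'M_p) (A^t* *m A) = (tensmx 1%:M A)^t* *m tensmx 1%:M A.
Proof. by rewrite adjmx_tens tensmx_mul trmx1 map_mx1 mulmx1. Qed.

(** By cyclicity the trace is the sum of the quadratic form of [A] over the rows of [N]. *)
Lemma psd_trace_ge0 m n (A : 'M[C]_n) (N : 'M[C]_(m, n)) :
  psd A -> 0 <= \tr (A *m (N^t* *m N)).
Proof.
move=> [_ A_pos]; rewrite mulmxA mxtrace_mulC mulmxA.
apply: sumr_ge0 => i _; have := A_pos ((row i N)^t*).
by rewrite trmxCK -row_mul -dotmxE dotmx_row.
Qed.

(** Otherwise [W] would be a nonnegative combination of its eigenprojections, each of which has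
    nonnegative trace against [A]. *)
Lemma psd_eigenvalue_lt0 n (W A : 'M[C]_n) :
  W \is hermsymmx -> psd A -> complex.Re (\tr (W *m A)) < 0 ->
  exists2 a : R, a < 0 & eigenvalue W a%:C.
Proof.
move=> Wh A_psd trWA.
have /mxOverP Dreal := hermitian_spectral_diag_real Wh.
pose D j := complex.Re (spectral_diag W 0 j).
have DE j : spectral_diag W 0 j = (D j)%:C by rewrite RRe_real.
have [/existsP[j Dj]|] := boolP [exists j, D j < 0].
  exists (D j) => //; apply/eigenvalueP; exists (row j (spectralmx W)).
    rewrite -row_mul {2}(hermitian_spectral Wh) !mulmxA.
    have /unitarymxP -> := spectral_unitarymx W.
    by rewrite mul1mx row_mul row_diag_mx -scalemxAl -rowE DE.
  apply/eqP => P0; have := row_unitary_norm j (spectral_unitarymx W).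
  rewrite P0 dotmx_sum big1 => [/eqP|k _]; last by rewrite mxE normr0 expr0n.
  by rewrite eq_sym oner_eq0.
rewrite negb_exists => /forallP D_ge0.
suff : 0 <= complex.Re (\tr (W *m A)) by rewrite leNgt trWA.
rewrite mxtrace_mulC (spectral_sum Wh) mulmx_sumr [\tr _]raddf_sum Re_sum.
apply: sumr_ge0 => j _ /=; rewrite -scalemxAr mxtraceZ DE Re_mulrC.
apply: mulr_ge0; first by rewrite leNgt.
by rewrite -ler0c -real_complex_Re psd_trace_ge0.
Qed.

Lemma hermsymm_trace_real n (A B : 'M[C]_n) :
  A \is hermsymmx -> B \is hermsymmx ->
  \tr (A *m B) = (complex.Re (\tr (A *m B)))%:C.
Proof.
move=> /hermsymmxP Ah /hermsymmxP Bh; rewrite RRe_real // CrealE; apply/eqP.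
rewrite -trace_map_mx -mxtrace_tr map_trmx -[LHS]/(\tr ((A *m B)^t*)).
by rewrite adjmx_mul Ah Bh mxtrace_mulC.
Qed.

(** A form of the basis conditions that passes to transposes, since the first tensor factor carries
    them. Hermiticity allows orthonormality to be written without the adjoint. *)
Definition hermitian_frame d n (g : 'I_(1 + n) -> 'M[C]_d) : Prop :=
  [/\ forall i, g i \is hermsymmx,
      forall i j, \tr (g i *m g j) = (i == j)%:R,
      g ord0 = ((Num.sqrt d%:R)^-1)%:C *: 1%:M
    & forall i, i != ord0 -> \tr (g i) = 0].

Lemma hermitian_op_basis_frame d (G : 'I_(dimL d) -> 'M[C]_d) :
  hermitian_op_basis G -> hermitian_frame G.
Proof.
case=> _ G_orth G_herm G0 G_tr; split=> // i j.
by rewrite -G_orth (hermsymmxP _ (G_herm j)).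
Qed.

Lemma hermitian_frame_tr d n (g : 'I_(1 + n) -> 'M[C]_d) :
  hermitian_frame g -> hermitian_frame (fun i => (g i)^T).
Proof.
case=> g_herm g_orth g0 g_tr; split=> [i|i j||i i0].
- apply/hermsymmxP; rewrite -[in RHS](hermsymmxP _ (g_herm i)).
  by rewrite map_trmx.
- by rewrite -trmx_mul mxtrace_tr g_orth eq_sym.
- by rewrite g0 linearZ /= trmx1.
- by rewrite mxtrace_tr g_tr.
Qed.

(** Stated for a positive unital functional so that it serves both single-factor densities and the
    marginals of a bipartite state. *)
Lemma frame_coord_bound d n (g : 'I_(1 + n) -> 'M[C]_d) (f : 'M[C]_d -> C) :
  hermitian_frame g ->
  scalar f -> f 1%:M = 1 -> (forall v : 'rV[C]_d, 0 <= f (v^t* *m v)) ->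
  euclid_norm (\row_i complex.Re (f (g (rshift 1 i)))) <= Nconst d 0.
Proof.
case=> g_herm g_orth _ g_tr; by apply: state_coord_bound => // i; apply: g_tr.
Qed.

Lemma density_coord_bound d n (h : 'I_(1 + n) -> 'M[C]_d) (X : 'M[C]_d) :
  hermitian_frame h -> density X ->
  euclid_norm (\row_i complex.Re (\tr (h (rshift 1 i) *m X))) <= Nconst d 0.
Proof.
move=> h_frame [X_psd trX].
apply: (@frame_coord_bound _ _ _ (fun B => \tr (B *m X))) => //.
- by move=> a B B'; rewrite mulmxDl -scalemxAl mxtraceD mxtraceZ.
- by rewrite mul1mx.
- by move=> v; rewrite mxtrace_mulC psd_trace_ge0.
Qed.

Lemma density_coord0 d n (h : 'I_(1 + n) -> 'M[C]_d) (X : 'M[C]_d) :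
  hermitian_frame h -> density X ->
  complex.Re (\tr (h ord0 *m X)) = (Num.sqrt d%:R)^-1.
Proof.
by case=> _ _ -> _ [_ trX]; rewrite -scalemxAl mul1mx mxtraceZ trX mulr1.
Qed.

Variables d1 d2 n1 n2 : nat.
Variables (g : 'I_(1 + n1) -> 'M[C]_d1) (o : 'I_(1 + n2) -> 'M[C]_d2).
Hypotheses (g_frame : hermitian_frame g) (o_frame : hermitian_frame o).

Definition op_of_frames (A : 'M[R]_(1 + n2, 1 + n1)) : 'M[C]_(d1 * d2) :=
  \sum_a \sum_b (A b a)%:C *: tensmx (g a) (o b).

Lemma op_of_frames_herm A : op_of_frames A \is hermsymmx.
Proof.
apply/hermsymmxP; rewrite raddf_sum /= raddf_sum /=; apply: eq_bigr => a _.
rewrite raddf_sum /= raddf_sum /=; apply: eq_bigr => b _.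
rewrite linearZ map_mxZ /= conjC_real_complex adjmx_tens.
case: g_frame o_frame => /(_ a)/hermsymmxP -> _ _ _.
by case=> /(_ b)/hermsymmxP -> _ _ _.
Qed.

Lemma trace_op_of_frames A (S : 'M[C]_(d1 * d2)) :
  \tr (op_of_frames A *m S)
    = \sum_a \sum_b (A b a)%:C * \tr (tensmx (g a) (o b) *m S).
Proof.
rewrite mulmx_suml raddf_sum; apply: eq_bigr => a _ /=.
rewrite mulmx_suml raddf_sum; apply: eq_bigr => b _ /=.
by rewrite -scalemxAl mxtraceZ.
Qed.

Lemma trace_mul_pairing m n (A B : 'M[R]_(m, n)) :
  \tr (A^T *m B) = \sum_a \sum_b A b a * B b a.
Proof.
by apply: eq_bigr => a _; rewrite mxE; apply: eq_bigr => b _; rewrite mxE.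
Qed.

(** Products of frame elements are again orthonormal, so the trace reads off one coefficient. *)
Lemma coef_of_frames A a b :
  \tr (tensmx (g a) (o b) *m op_of_frames A) = (A b a)%:C.
Proof.
rewrite mxtrace_mulC trace_op_of_frames (bigD1 a) //= (bigD1 b) //=.
case: g_frame o_frame => _ g_orth _ _ [_ o_orth _ _].
have trE a' b' : \tr (tensmx (g a') (o b') *m tensmx (g a) (o b))
    = (a' == a)%:R * (b' == b)%:R.
  by rewrite tensmx_mul mxtrace_tens g_orth o_orth.
rewrite trE !eqxx !mulr1 !big1 ?addr0 // => [a' /negPf a'a|b' /negPf b'b].
  by rewrite big1 // => b' _; rewrite trE a'a mul0r mulr0.
by rewrite trE b'b !mulr0.
Qed.

Lemma trace_op_op A B :
  \tr (op_of_frames A *m op_of_frames B) = (\tr (A^T *m B))%:C.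
Proof.
rewrite trace_op_of_frames trace_mul_pairing rmorph_sum.
apply: eq_bigr => a _; rewrite rmorph_sum; apply: eq_bigr => b _.
by rewrite coef_of_frames rmorphM.
Qed.

(** A product operator enters the pairing through the rank-one matrix of its two coordinate
    vectors. *)
Lemma trace_op_tens A (X : 'M[C]_d1) (Y : 'M[C]_d2) :
    X \is hermsymmx -> Y \is hermsymmx ->
    let x := \row_a complex.Re (\tr (g a *m X)) in
    let y := \row_b complex.Re (\tr (o b *m Y)) in
  \tr (op_of_frames A *m tensmx X Y) = (\tr (A^T *m (y^T *m x)))%:C.
Proof.
move=> Xh Yh x y; rewrite trace_op_of_frames trace_mul_pairing rmorph_sum.
apply: eq_bigr => a _; rewrite rmorph_sum; apply: eq_bigr => b _.
rewrite rmorphM tensmx_mul mxtrace_tens; congr (_ * _).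
case: g_frame o_frame => g_herm _ _ _ [o_herm _ _ _].
rewrite (hermsymm_trace_real (g_herm a) Xh) (hermsymm_trace_real (o_herm b) Yh).
by rewrite mxE big_ord1 !mxE -rmorphM mulrC.
Qed.

Lemma lshift_ord0 n : lshift n (0 : 'I_1) = ord0.
Proof. exact: val_inj. Qed.

(** * Coordinates of a state, and nonnegativity of the class on it *)

Section State.
Variables (rho : 'M[C]_(d1 * d2)) (B : 'M[R]_(1 + n2, 1 + n1)).
Hypotheses (rho_density : density rho) (rhoE : rho = op_of_frames B).

Lemma state_ulsubmx :
  ulsubmx B 0 0 = (Num.sqrt d1%:R)^-1 * (Num.sqrt d2%:R)^-1.
Proof.
apply: (@complexI R); rewrite !mxE -coef_of_frames -rhoE.
rewrite !lshift_ord0.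
case: g_frame o_frame => _ _ -> _ [_ _ -> _].
rewrite tensmxZl tensmxZr tensmx11 -!scalemxAl mul1mx !mxtraceZ.
by case: rho_density => _ ->; rewrite mulr1 rmorphM.
Qed.

(** Up to the factor from [o ord0], the entries are the coordinates of the first marginal of [rho],
    here the functional [f]. *)
Lemma state_ursubmx :
  euclid_norm (ursubmx B) <= Nconst d1 0 * (Num.sqrt d2%:R)^-1.
Proof.
case: rho_density => rho_psd trrho.
pose f (M : 'M[C]_d1) := \tr (tensmx M 1%:M *m rho).
have -> : ursubmx B =
    (Num.sqrt d2%:R)^-1 *: \row_i complex.Re (f (g (rshift 1 i))).
  apply/rowP => i; apply: (@complexI R); rewrite !mxE -coef_of_frames -rhoE.
  rewrite lshift_ord0.
  case: o_frame => _ _ -> _; rewrite tensmxZr -scalemxAl mxtraceZ rmorphM.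
  congr (_ * _); apply: hermsymm_trace_real; last first.
    by rewrite rhoE op_of_frames_herm.
  apply/hermsymmxP; rewrite adjmx_tens.
  case: g_frame => /(_ (rshift 1 i))/hermsymmxP -> _ _ _.
  by rewrite trmx1 map_mx1.
rewrite euclid_normZ ?invr_ge0 ?sqrtr_ge0 // mulrC.
rewrite ler_wpM2r ?invr_ge0 ?sqrtr_ge0 //; apply: frame_coord_bound => //.
- by move=> a M M'; rewrite /f tensmxPl mulmxDl -scalemxAl mxtraceD mxtraceZ.
- by rewrite /f tensmx11 mul1mx.
by move=> v; rewrite /f mxtrace_mulC tens_gram1 psd_trace_ge0.
Qed.

Lemma state_dlsubmx :
  euclid_norm (dlsubmx B)^T <= Nconst d2 0 * (Num.sqrt d1%:R)^-1.
Proof.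
case: rho_density => rho_psd trrho.
pose f (M : 'M[C]_d2) := \tr (tensmx 1%:M M *m rho).
have -> : (dlsubmx B)^T =
    (Num.sqrt d1%:R)^-1 *: \row_i complex.Re (f (o (rshift 1 i))).
  apply/rowP => i; apply: (@complexI R); rewrite !mxE -coef_of_frames -rhoE.
  rewrite lshift_ord0.
  case: g_frame => _ _ -> _; rewrite tensmxZl -scalemxAl mxtraceZ rmorphM.
  congr (_ * _); apply: hermsymm_trace_real; last first.
    by rewrite rhoE op_of_frames_herm.
  apply/hermsymmxP; rewrite adjmx_tens.
  case: o_frame => /(_ (rshift 1 i))/hermsymmxP -> _ _ _.
  by rewrite trmx1 map_mx1.
rewrite euclid_normZ ?invr_ge0 ?sqrtr_ge0 // mulrC.
rewrite ler_wpM2r ?invr_ge0 ?sqrtr_ge0 //; apply: frame_coord_bound => //.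
- by move=> a M M'; rewrite /f tensmxPr mulmxDl -scalemxAl mxtraceD mxtraceZ.
- by rewrite /f tensmx11 mul1mx.
by move=> v; rewrite /f mxtrace_mulC tens_1gram psd_trace_ge0.
Qed.

(** The corner term dominates the three others: Cauchy-Schwarz bounds row and column, trace duality
    bounds the block. *)
Lemma trace_op_ge0 A : (0 < d1)%N ->
  trace_norm (block_mx (0 : 'M_(1, 1)) 0 0 (drsubmx B))
    <= Nconst d1 0 * Nconst d2 0 ->
  Num.sqrt (d2%:R - 1) * euclid_norm (dlsubmx A)^T
    + Num.sqrt (d1%:R - 1) * euclid_norm (ursubmx A)
    + Num.sqrt ((d1%:R - 1) * (d2%:R - 1)) * operator_norm (drsubmx A)
    <= ulsubmx A 0 0 ->
  0 <= \tr (op_of_frames A *m rho).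
Proof.
move=> d1_gt0 tr_le A_le.
rewrite rhoE trace_op_op ler0c pairing_block state_ulsubmx.
have dr_ge : - (operator_norm (drsubmx A) * (Nconst d1 0 * Nconst d2 0))
    <= \tr ((drsubmx A)^T *m drsubmx B).
  (* The block of [A] is padded with zeros, since the hypothesis bounds the trace norm of the padded
     block of [B]. *)
  rewrite lerNl; apply: (@le_trans _ _
    (operator_norm (drsubmx A)
     * trace_norm (block_mx (0 : 'M_(1, 1)) 0 0 (drsubmx B)))).
    have -> : - \tr ((drsubmx A)^T *m drsubmx B) =
        \tr ((- drsubmx A)^T *m drsubmx B).
      by rewrite [(- _)^T]linearN mulNmx raddfN.
    have -> : \tr ((- drsubmx A)^T *m drsubmx B) =
        \tr ((block_mx (0 : 'M_(1, 1)) 0 0 (- drsubmx A))^T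
             *m block_mx (0 : 'M_(1, 1)) 0 0 (drsubmx B)).
      rewrite tr_block_mx mulmx_block mxtrace_block !trmx0.
      by rewrite !(mul0mx, mulmx0, add0r, addr0) mxtrace0 add0r.
    apply: inner_le_trace_norm; first exact: operator_norm_ge0.
    by apply/norm_le_block_mx/norm_leN/norm_le_operator_norm.
  by rewrite ler_wpM2l ?operator_norm_ge0.
have ur_ge : - (euclid_norm (ursubmx A) * (Nconst d1 0 * (Num.sqrt d2%:R)^-1))
    <= \sum_j ursubmx A 0 j * ursubmx B 0 j.
  apply: le_trans (cauchy_schwarzN _ _).
  by rewrite lerN2 ler_wpM2l ?euclid_norm_ge0 ?state_ursubmx.
have dl_ge : - (euclid_norm (dlsubmx A)^T * (Nconst d2 0 * (Num.sqrt d1%:R)^-1))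
    <= \sum_j (dlsubmx A)^T 0 j * (dlsubmx B)^T 0 j.
  apply: le_trans (cauchy_schwarzN _ _).
  by rewrite lerN2 ler_wpM2l ?euclid_norm_ge0 ?state_dlsubmx.
rewrite !Nconst0E in dr_ge ur_ge dl_ge.
rewrite sqrtrM ?subr_ge0 ?ler1n // in A_le.
apply: le_trans (lerD (lerD (lerD (lexx _) ur_ge) dl_ge) dr_ge).
move: (ulsubmx A 0 0) (euclid_norm _) (euclid_norm _) (operator_norm _) A_le.
move: (Num.sqrt (d1%:R - 1)) (Num.sqrt (d2%:R - 1)) => r1 r2 t s u L A_le.
have q1_ge0 : 0 <= (Num.sqrt d1%:R)^-1 :> R by rewrite invr_ge0 sqrtr_ge0.
have q2_ge0 : 0 <= (Num.sqrt d2%:R)^-1 :> R by rewrite invr_ge0 sqrtr_ge0.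
move: (_^-1) (_^-1) q1_ge0 q2_ge0 => q1 q2 q1_ge0 q2_ge0.
(* With the common normalisation [q1 * q2] factored out, what remains is the inequality defining the
   class. *)
rewrite (_ : _ - _ = q1 * q2 * (t - (r2 * u + r1 * s + r1 * r2 * L)));
  last by ring.
by rewrite !mulr_ge0 // subr_ge0.
Qed.

End State.

(** By convexity a product state suffices. Its corner is fixed by normalisation, and the block
    subtracts at most [mu] times the product of the two Bloch bounds. *)
Lemma separable_trace_ge0 (Lam : 'M[R]_(n2, n1)) mu S :
  0 <= mu -> norm_le mu Lam ->
  mu * (Nconst d1 0 * Nconst d2 0)
    <= (Num.sqrt d1%:R)^-1 * (Num.sqrt d2%:R)^-1 ->
  separable S ->
  0 <= \tr (op_of_frames (block_mx 1%:M 0 0 (- Lam)) *m S).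
Proof.
move=> mu_ge0 LamL mu_le [k [p [X [Y [p_ge0 _ X_density Y_density ->]]]]].
rewrite mulmx_sumr [\tr _]raddf_sum sumr_ge0 // => i _ /=.
rewrite -scalemxAr mxtraceZ mulr_ge0 ?ler0c //.
have [[Xh _] [Yh _]] : psd (X i) /\ psd (Y i).
  by split; [case: (X_density i)|case: (Y_density i)].
rewrite trace_op_tens // ler0c pairing_block.
rewrite block_mxKul block_mxKur block_mxKdl block_mxKdr.
rewrite big1 ?addr0 => [|j _]; last by rewrite mxE mul0r.
rewrite big1 ?addr0 => [|j _]; last by rewrite trmx0 mxE mul0r.
set y := \row_b _; set x := \row_a _.
have -> : ulsubmx (y^T *m x) 0 0 = (Num.sqrt d1%:R)^-1 * (Num.sqrt d2%:R)^-1.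
  rewrite !mxE big_ord1 !mxE mulrC.
  rewrite !lshift_ord0.
  by rewrite !density_coord0.
rewrite mxE mul1r [(- Lam)^T]linearN mulNmx [\tr _]raddfN /= subr_ge0.
apply: le_trans mu_le.
have -> : drsubmx (y^T *m x) = (rsubmx y)^T *m rsubmx x.
  by rewrite -{1}[x]hsubmxK -{1}[y]hsubmxK tr_row_mx mul_col_row block_mxKdr.
apply: le_trans (norm_le_pairing _ _ mu_ge0 LamL) _; rewrite ler_wpM2l //.
have xE : rsubmx x = \row_a complex.Re (\tr (g (rshift 1 a) *m X i)).
  by apply/rowP => a; rewrite !mxE.
have yE : rsubmx y = \row_b complex.Re (\tr (o (rshift 1 b) *m Y i)).
  by apply/rowP => b; rewrite !mxE.
by rewrite ler_pM ?euclid_norm_ge0 // ?xE ?yE density_coord_bound.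
Qed.

End Operators.

(** * Dimension one, and the equivalence of the criterion with the witness class *)

Section Criterion.
Variable R : realType.

Lemma mxtrace_mul_0dim m n (A : 'M[R]_(n, m)) (B : 'M[R]_(m, n)) :
  (m == 0)%N || (n == 0)%N -> \tr (A *m B) = 0.
Proof.
case/orP=> /eqP m0; [rewrite mxtrace_mulC|]; rewrite /mxtrace big1 // => i.
  by exfalso; case: i => i; rewrite m0.
by exfalso; case: i => i; rewrite m0.
Qed.

(** In dimension one there are no traceless basis elements, so the correlation block is empty. *)
Lemma dimL_1_sub d : d%:R - 1 = 0 :> R -> (d ^ 2 - 1 = 0)%N.
Proof. by move=> /eqP; rewrite subr_eq0 pnatr_eq1 => /eqP ->. Qed.

End Criterion.

Theorem theorem3 (R : realType) (d1 d2 : nat) (d1_gt0 : (0 < d1)%N)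
    (d2_gt0 : (0 < d2)%N)
    (G : 'I_(dimL d1) -> 'M[R[i]]_d1) (O : 'I_(dimL d2) -> 'M[R[i]]_d2)
    (G_basis : hermitian_op_basis G) (O_basis : hermitian_op_basis O)
    (rho : 'M[R[i]]_(d1 * d2)) (rho_density : density rho)
    (C : 'M[R]_(dimL d2, dimL d1)) (rhoE : rho = op_of_coef G O C) :
  Nconst d1 (0 : R) * Nconst d2 (0 : R)
    = Num.sqrt ((d1%:R - 1) * (d2%:R - 1) / (d1%:R * d2%:R)) :> R
  /\ (trace_norm (Dmx d2 0 *m C *m Dmx d1 0)
        <= Nconst d1 (0 : R) * Nconst d2 (0 : R)
      <-> forall W : 'M[R[i]]_(d1 * d2),
            witness_class G O W -> 0 <= \tr (W *m rho)).
Proof.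
pose g i := (G i)^T.
have g_frame : hermitian_frame g.
  exact/hermitian_frame_tr/hermitian_op_basis_frame.
have o_frame : hermitian_frame O := hermitian_op_basis_frame O_basis.
have opE A : op_of_coef G O A = op_of_frames g O A by [].
split.
  rewrite -sqrtrM ?expr0n ?addr0 ?mulf_div //.
  by rewrite divr_ge0 ?ler0n // subr_ge0 ler1n.
rewrite Dmx0_mul; split=> [tr_le W [_ [A -> A_le]]|W_ge0].
  rewrite opE; exact: (trace_op_ge0 g_frame o_frame rho_density rhoE).
rewrite leNgt; apply/negP => lt_tr.
set M := block_mx _ _ _ _ in lt_tr.
have N_ge0 : 0 <= Nconst d1 (0 : R) * Nconst d2 0.
  by rewrite mulr_ge0 ?Nconst_ge0.
have [X X_le trX] := trace_norm_attained M.
have drX : \tr ((drsubmx X)^T *m drsubmx C) = trace_norm M.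
  rewrite -trX -[X in _ = \tr (X^T *m _)]submxK /M tr_block_mx mulmx_block.
  by rewrite mxtrace_block !mulmx0 !add0r mxtrace0 add0r.
(* If some dimension is 1, the block is empty and the trace norm is 0, so the criterion cannot
   fail. *)
have [r0|r_neq0] := eqVneq ((d1%:R - 1) * (d2%:R - 1)) (0 : R).
  move: lt_tr; rewrite -drX mxtrace_mul_0dim ?ltNge ?N_ge0 //.
  move/eqP: r0; rewrite mulf_eq0 => /orP[]/eqP/dimL_1_sub -> //.
  by rewrite orbT.
pose r : R := Num.sqrt (d1%:R - 1) * Num.sqrt (d2%:R - 1).
have rE : Num.sqrt ((d1%:R - 1) * (d2%:R - 1)) = r.
  by rewrite sqrtrM // subr_ge0 ler1n.
have r_gt0 : 0 < r.
  by rewrite -rE sqrtr_gt0 lt_def r_neq0 mulr_ge0 ?subr_ge0 ?ler1n.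
have XL : norm_le r^-1 (r^-1 *: drsubmx X).
  by rewrite -[X in norm_le X]mulr1; apply/norm_leZ/norm_le_drsubmx.
(* The scale [r^-1] is the largest block norm the class allows for corner 1 and [s = t = 0]; it is
   also the one at which the product-state bound equals the corner term. *)
have rN : r^-1 * (Nconst d1 0 * Nconst d2 0)
    = (Num.sqrt d1%:R)^-1 * (Num.sqrt d2%:R)^-1.
  by rewrite !Nconst0E // mulrACA mulKf // gt_eqF.
(* The minus sign makes the block subtract the whole trace norm, so the trace against [rho] is
   negative exactly when the criterion fails. *)
pose A : 'M[R]_(dimL d2, dimL d1) := block_mx 1%:M 0 0 (- (r^-1 *: drsubmx X)).
have trW : \tr (op_of_frames g O A *m rho) =
    (r^-1 * (Nconst d1 0 * Nconst d2 0 - trace_norm M))%:C.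
  rewrite rhoE opE trace_op_op // pairing_block /A.
  rewrite (state_ulsubmx g_frame o_frame rho_density rhoE).
  rewrite block_mxKul block_mxKur block_mxKdl block_mxKdr.
  rewrite big1 ?addr0 => [|j _]; last by rewrite mxE mul0r.
  rewrite big1 ?addr0 => [|j _]; last by rewrite trmx0 mxE mul0r.
  rewrite mxE mul1r -scalerN linearZ /= -scalemxAl mxtraceZ.
  rewrite [(- drsubmx X)^T]linearN mulNmx [\tr (- _)]raddfN /= drX.
  by rewrite mulrBr rN mulrN.
have trW_lt0 : r^-1 * (Nconst d1 0 * Nconst d2 0 - trace_norm M) < 0.
  by rewrite pmulr_rlt0 ?invr_gt0 // subr_lt0.
have : 0 <= \tr (op_of_frames g O A *m rho).
  apply: W_ge0; split; last first.
    exists A => //; rewrite /A block_mxKul block_mxKur block_mxKdl block_mxKdr.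
    have e0 n : euclid_norm (0 : 'rV[R]_n) = 0.
      by rewrite /euclid_norm big1 ?sqrtr0 // => j _; rewrite mxE expr0n.
    rewrite trmx0 !e0 !mulr0 !add0r rE mxE.
    rewrite mulrC -ler_pdivlMr // mul1r.
    by apply: operator_norm_le; rewrite ?invr_ge0 ?ltW //; apply: norm_leN.
  split; first exact: op_of_frames_herm.
  (* The negative eigenvalue comes from [rho] itself, on which the operator has negative trace. *)
  - apply: (@psd_eigenvalue_lt0 _ _ _ rho); first exact: op_of_frames_herm.
      by case: rho_density.
    by rewrite trW.
  - move=> S; apply: (separable_trace_ge0 g_frame o_frame _ XL).
      by rewrite invr_ge0 ltW.
    by rewrite rN.
by rewrite trW ler0c leNgt trW_lt0.
Qed.
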